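(* Let $(X,d)$ be a metric space and let $M$ be a closed nonempty proper subset of $X$. Let $F:(X\setminus M,d)\to(0,\infty)$ be a $1$-Lipschitz function. Then the metric defined by $$j(x,y)=\frac12\log\left[\left(1+\frac{d(x,y)}{F(x)}\right)\left(1+\frac{d(x,y)}{F(y)}\right)\right],\qquad x,y\in X\setminus M,$$ is Gromov hyperbolic with a Gromov constant $\delta\le\frac14\log 24$.
   Context: $\log$ is the natural logarithm. $F$ is $1$-Lipschitz if $|F(x)-F(y)|\le d(x,y)$ for all $x,y\in X\setminus M$. The function $j$ is a metric on $X\setminus M$. A metric $\rho$ on a set $S$ is Gromov hyperbolic with Gromov constant $\delta\ge 0$ if for all $x,y,z,w\in S$ $$\rho(x,z)+\rho(y,w)\le\max\{\rho(x,w)+\rho(y,z),\ \rho(x,y)+\rho(z,w)\}+2\delta .$$ *)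

(* Defs.v *)
From mathcomp Require Export all_boot all_order all_algebra.
From mathcomp Require Export all_classical all_reals all_analysis.

Set Implicit Arguments.
Unset Strict Implicit.
Unset Printing Implicit Defensive.

Import Order.TTheory GRing.Theory Num.Theory.

Local Open Scope classical_set_scope.
Local Open Scope ring_scope.

Definition is_metric (R : realType) (S : Type) (rho : S -> S -> R) : Prop :=
  [/\ forall x y, 0 <= rho x y,
      forall x y, rho x y = 0 <-> x = y,
      forall x y, rho x y = rho y x
    & forall x y z, rho x z <= rho x y + rho y z].

Definition gromov_constant (R : realType) (S : Type) (rho : S -> S -> R)
    (delta : R) : Prop :=
  0 <= delta /\
  forall x y z w : S,
    rho x z + rho y w <=
      Num.max (rho x w + rho y z) (rho x y + rho z w) + 2 * delta.

(* Functions on a subset [A] of [X] are functions on the subtype [set_type A];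
   [\val] is the inclusion into [X]. *)
Definition lipschitz1 (R : realType) (X : metricType R) (A : set X)
    (F : set_type A -> R) : Prop :=
  forall x y : set_type A, `|F x - F y| <= mdist (\val x) (\val y).

Definition jdist (R : realType) (X : metricType R) (A : set X)
    (F : set_type A -> R) (x y : set_type A) : R :=
  let d := mdist (\val x) (\val y) in
  2^-1 * ln ((1 + d / F x) * (1 + d / F y)).

(* Main.v *)
Require Import Defs.
From mathcomp Require Import all_boot all_order all_algebra.
From mathcomp Require Import all_classical all_reals all_analysis.
From mathcomp Require Import ring lra.

(** Write [swell x y = (F x + d(x,y)) * (F y + d(x,y))], so that [jdist F x y]
    is half the logarithm of [swell x y / (F x * F y)].

    For the four-point inequality, all three pairings of x, y, z, w carry the
    same denominator [F x * F y * F z * F w], so the constant [ln 24 / 4] amounts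
    to [swell x z * swell y w <= 24 * m], where [m] is the larger of
    [swell x w * swell y z] and [swell x y * swell z w].  Rotate the cycle
    x, y, z, w so that its shortest side is xy; then the first of these two
    products already suffices.  Indeed [swell x z] is compared with [swell y z]
    by moving x to y.  As d(x,y) <= d(y,z), we have d(x,z) <= 2 d(y,z), while
    [F x <= F y + d(y,z)]; so the two factors of [swell] lose at most 3 and 2,
    which makes 6 ([swell_move]).  In the same way [swell y w <= 6 * swell x w]
    by moving y to x, which would give 36 in all.  But one of these two opposite
    moves goes towards the larger value of [F], and that one loses only
    2 * 2 = 4 ([swell_move_up]): the product is 24 ([swell_short_side]).

    For the triangle inequality, each of the two factors in the argument of the
    logarithm is submultiplicative along a path by itself, because the Lipschitz
    condition gives [F y <= F x + d(x,y)] ([ratio_path]); the path is followed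
    forwards for one factor and backwards for the other. *)

Local Open Scope classical_set_scope.
Local Open Scope ring_scope.

Import Order.TTheory GRing.Theory Num.Theory.

(** After a step of length [p] from weight [a], a further step of length [q]
    multiplies [1 + p / a] by exactly [1 + q / (a + p)]; as [b <= a + p],
    measuring that step relative to [b] only increases it. *)
Lemma ratio_path (R : realFieldType) (a b p q s : R) :
  0 < a -> 0 < b -> 0 <= q -> b <= a + p -> s <= p + q ->
  1 + s / a <= (1 + p / a) * (1 + q / b).
Proof.
move=> a0 b0 q0 bap spq.
have qab : q / (a + p) <= q / b.
  by apply: ler_wpM2l => //; rewrite lef_pV2 ?posrE // (lt_le_trans b0).
have ap0 : 0 < a + p by apply: lt_le_trans bap.
apply: (@le_trans _ _ ((1 + p / a) * (1 + q / (a + p)))).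
  have -> : (1 + p / a) * (1 + q / (a + p)) = 1 + (p + q) / a.
    by field; rewrite !gt_eqF.
  by rewrite lerD2l ler_pM2r ?invr_gt0.
apply: ler_wpM2l; last by rewrite lerD2l.
have -> : 1 + p / a = (a + p) / a by field; rewrite gt_eqF.
by rewrite divr_ge0 ?ltW.
Qed.

Section JDist.
Context (R : realType) (X : metricType R) (A : set X) (F : set_type A -> R).
Hypotheses (F_gt0 : forall x, 0 < F x) (F_lip : lipschitz1 F).

Implicit Types x y z u v w : set_type A.

Local Notation dist x y := (mdist (\val x) (\val y)).

Let dist_ge0 x y : 0 <= dist x y. Proof. exact: mdist_ge0. Qed.
Local Hint Resolve dist_ge0 F_gt0 : core.

Lemma lipschitz1_le x y : F x <= F y + dist x y.
Proof. by have := F_lip x y; rewrite ler_norml => /andP[_]; lra. Qed.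

Lemma ratio_ge1 x (t : R) : 0 <= t -> 1 <= 1 + t / F x.
Proof. by move=> t0; rewrite lerDl divr_ge0 // ltW. Qed.

Lemma ratio_gt0 x (t : R) : 0 <= t -> 0 < 1 + t / F x.
Proof. by move=> t0; rewrite (lt_le_trans ltr01) ?ratio_ge1. Qed.

Lemma jdistE x y :
  jdist F x y = 2^-1 * (ln (1 + dist x y / F x) + ln (1 + dist x y / F y)).
Proof. by rewrite /jdist lnM // posrE ratio_gt0. Qed.

Lemma jdistC x y : jdist F x y = jdist F y x.
Proof. by rewrite !jdistE metric_sym [X in _ * X]addrC. Qed.

Lemma jdist_ge0 x y : 0 <= jdist F x y.
Proof. by rewrite jdistE mulr_ge0 ?invr_ge0 // addr_ge0 // ln_ge0 // ratio_ge1. Qed.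

Lemma jdist_eq0 x y : jdist F x y = 0 <-> x = y.
Proof.
split=> [|->]; last by rewrite jdistE mdistxx !mul0r addr0 ln1 addr0 mulr0.
move=> j0; apply: val_inj; apply: mdist_positivity.
apply/eqP; rewrite eq_le mdist_ge0 andbT leNgt; apply/negP => d0.
suff : 0 < jdist F x y by rewrite j0 ltxx.
by rewrite jdistE mulr_gt0 ?invr_gt0 // addr_gt0 // ln_gt0 // ltrDl divr_gt0.
Qed.

Lemma jdist_triangle x y z : jdist F x z <= jdist F x y + jdist F y z.
Proof.
have path u v w : ln (1 + dist u w / F u)
    <= ln (1 + dist u v / F u) + ln (1 + dist v w / F v).
  rewrite -lnM ?posrE ?ratio_gt0 // ler_ln ?posrE ?mulr_gt0 ?ratio_gt0 //.
  apply: ratio_path => //; last exact: metric_triangle.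
  by rewrite metric_sym lipschitz1_le.
have := path x y z; have := path z y x.
rewrite !jdistE (metric_sym (\val z)) (metric_sym (\val z)).
rewrite (metric_sym (\val y) (\val x)).
lra.
Qed.

Lemma jdist_is_metric : is_metric (jdist F).
Proof.
by split; [exact: jdist_ge0|exact: jdist_eq0|exact: jdistC|exact: jdist_triangle].
Qed.

(** The numerator of the argument of the logarithm in [jdist]: the denominator
    is the same for every pairing of four points, so only this part matters in
    the four-point inequality. *)
Definition swell x y := (F x + dist x y) * (F y + dist x y).

Lemma swell_gt0 x y : 0 < swell x y.
Proof. by rewrite mulr_gt0 // ltr_wpDr. Qed.

Lemma jdist_swell x y :
  jdist F x y = 2^-1 * (ln (swell x y) - ln (F x) - ln (F y)).
Proof.
rewrite jdistE /swell lnM ?posrE ?ltr_wpDr //.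
have ratioE u t : 0 <= t -> ln (1 + t / F u) = ln (F u + t) - ln (F u).
  move=> t0; rewrite -ln_div ?posrE ?ltr_wpDr //; congr ln.
  by field; rewrite gt_eqF.
by rewrite !ratioE //; congr (_ * _); ring.
Qed.

(** Replacing x by y multiplies the first factor by at most 3, since
    [F x + d(x,z) <= (F y + d(y,z)) + 2 d(y,z)], and the second by at most 2. *)
Lemma swell_move x y z : dist x y <= dist y z -> swell x z <= 6 * swell y z.
Proof.
move=> xy_yz; have Fxy := lipschitz1_le x y.
have xz := metric_triangle (\val x) (\val y) (\val z).
have Fx := F_gt0 x; have Fy := F_gt0 y; have Fz := F_gt0 z.
have xz0 := dist_ge0 x z.
have -> : 6 * swell y z = 3 * (F y + dist y z) * (2 * (F z + dist y z)).
  by rewrite /swell; ring.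
apply: ler_pM; lra.
Qed.

(** Without a drop of [F] to pay for, the first factor also grows by at most 2. *)
Lemma swell_move_up x y z :
  F x <= F y -> dist x y <= dist y z -> swell x z <= 4 * swell y z.
Proof.
move=> Fxy xy_yz.
have xz := metric_triangle (\val x) (\val y) (\val z).
have Fx := F_gt0 x; have Fy := F_gt0 y; have Fz := F_gt0 z.
have xz0 := dist_ge0 x z.
have -> : 4 * swell y z = 2 * (F y + dist y z) * (2 * (F z + dist y z)).
  by rewrite /swell; ring.
apply: ler_pM; lra.
Qed.

(** The moves x to y and y to x cannot both go down in [F], so one costs 4 and
    the other 6. *)
Lemma swell_short_side x y z w :
  dist x y <= dist y z -> dist x y <= dist x w ->
  swell x z * swell y w <= 24 * (swell x w * swell y z).
Proof.
move=> xy_yz xy_xw; have yx_xw : dist y x <= dist x w by rewrite metric_sym.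
have [Fxy|/ltW Fyx] := leP (F x) (F y).
- have -> : 24 * (swell x w * swell y z) = 4 * swell y z * (6 * swell x w).
    by ring.
  by apply: ler_pM; rewrite ?(ltW (swell_gt0 _ _)) ?swell_move_up ?swell_move.
- have -> : 24 * (swell x w * swell y z) = 6 * swell y z * (4 * swell x w).
    by ring.
  by apply: ler_pM; rewrite ?(ltW (swell_gt0 _ _)) ?swell_move_up ?swell_move.
Qed.

Lemma jdist_short_side x y z w :
  dist x y <= dist y z -> dist x y <= dist x w ->
  jdist F x z + jdist F y w <= jdist F x w + jdist F y z + 2^-1 * ln 24.
Proof.
move=> xy_yz xy_xw; have := swell_short_side x y z w xy_yz xy_xw.
have swellM_gt0 u v u' v' : 0 < swell u v * swell u' v'.
  by apply: mulr_gt0; exact: swell_gt0.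
have lnM_swell u v u' v' :
    ln (swell u v * swell u' v') = ln (swell u v) + ln (swell u' v').
  by apply: lnM; rewrite posrE; exact: swell_gt0.
have lnM24 t : 0 < t -> ln (24 * t) = ln 24 + ln t :> R.
  by move=> t0; rewrite lnM ?posrE.
rewrite -ler_ln ?posrE //; last by rewrite mulr_gt0.
rewrite lnM_swell lnM24 // lnM_swell.
rewrite !jdist_swell; lra.
Qed.

(** Turning the cycle x, y, z, w by one step exchanges the two pairings on the
    right and fixes the one on the left, so any side may serve as the shortest
    one in [jdist_short_side]: xy and zw lead to the first term of the maximum,
    yz and wx to the second. *)
Lemma jdist_gromov : gromov_constant (jdist F) (4^-1 * ln 24).
Proof.
split=> [|x y z w]; first by rewrite mulr_ge0 ?invr_ge0 ?ln_ge0 ?ler1n.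
have -> : 2 * (4^-1 * ln 24) = 2^-1 * ln 24 :> R by field.
have lel (a b c e : R) : a <= b + e -> a <= Num.max b c + e.
  by move/le_trans; apply; rewrite lerD2r le_max lexx.
have ler (a b c e : R) : a <= c + e -> a <= Num.max b c + e.
  by move/le_trans; apply; rewrite lerD2r le_max lexx orbT.
have xy := metric_sym (\val x) (\val y).
have yz := metric_sym (\val y) (\val z).
have zw := metric_sym (\val z) (\val w).
have wx := metric_sym (\val w) (\val x).
have jxy := jdistC x y; have jyz := jdistC y z.
have jzw := jdistC z w; have jwx := jdistC w x.
have jxz := jdistC x z; have jyw := jdistC y w.
have [xz_side|yw_side] := leP (Num.min (dist x y) (dist z w))
                              (Num.min (dist y z) (dist w x)).
- apply: lel; move: xz_side; have [_|_] := leP (dist x y) (dist z w).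
  + rewrite le_min => /andP[h1 h2].
    by apply: jdist_short_side; rewrite -?wx.
  + rewrite le_min => /andP[h1 h2].
    have := @jdist_short_side z w x y; rewrite -yz => /(_ h2 h1); lra.
- apply: ler; move/ltW: yw_side; have [_|_] := leP (dist y z) (dist w x).
  + rewrite le_min => /andP[h1 h2].
    have := @jdist_short_side y z w x; rewrite -xy => /(_ h2 h1); lra.
  + rewrite le_min => /andP[h1 h2].
    have := @jdist_short_side w x y z; rewrite -zw => /(_ h1 h2); lra.
Qed.

End JDist.

Theorem theorem4 (R : realType) (X : metricType R) (M : set X)
    (M_closed : closed M) (M_nonempty : M !=set0) (M_proper : M <> setT)
    (F : set_type (~` M) -> R) (F_gt0 : forall x, 0 < F x)
    (F_lip : lipschitz1 F) :
  is_metric (jdist F) /\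
  exists delta : R, delta <= 4^-1 * ln 24 /\ gromov_constant (jdist F) delta.
Proof.
split; first exact: jdist_is_metric.
by exists (4^-1 * ln 24); split=> //; apply: jdist_gromov.
Qed.
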